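(* Let $r_n:=|\mathfrak{A}_{2n+1}(2413,3142)|$, $R(x):=\sum_{n\ge1}r_nx^n$, $t_n:=|\mathfrak{A}_{2n}(2413,3142)|$ for $n\ge1$, and $T(x):=\sum_{n\ge1}t_nx^n$. Then $$\tfrac12R(x)=\tfrac12R(x)T(x)+T(x).$$ Consequently $t_1=1$ and for $n\ge2$, $$t_n=\frac{4}{n-1}\sum_{i=0}^{n-2}2^i\binom{2n-1}{i}\binom{n-1}{i+1}.$$
   Context: $\mathfrak{A}_m(2413,3142)$ is the set of permutations $\pi$ of $[m]$ that are alternating (up-down), i.e. $\pi(1)<\pi(2)>\pi(3)<\pi(4)>\cdots$, and avoid both classical patterns $2413$ and $3142$. *)

(* Defs.v *)
From HB Require Import structures.
From mathcomp Require Import all_boot all_order all_fingroup all_algebra.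
Set Implicit Arguments. Unset Strict Implicit. Unset Printing Implicit Defensive.
Import Order.TTheory GRing.Theory Num.Theory.

(* Permutations of [m] are elements of 'S_m; position p (1-based) is the
   ordinal p-1, and the value pi(p) is s (p-1) (values 0..m-1, order preserved). *)

(* pi(1) < pi(2) > pi(3) < pi(4) > ... : with 0-based positions, an ascent
   at even i and a descent at odd i. *)
Definition alternating (m : nat) (s : 'S_m) : bool :=
  [forall i : 'I_m, forall j : 'I_m,
     (val j == (val i).+1) ==> (if odd i then (s j < s i)%N else (s i < s j)%N)].

Definition contains2413 (m : nat) (s : 'S_m) : bool :=
  [exists i : 'I_m, exists j : 'I_m, exists k : 'I_m, exists l : 'I_m,
     [&& (i < j)%N, (j < k)%N, (k < l)%N,
         (s k < s i)%N, (s i < s l)%N & (s l < s j)%N]].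

Definition contains3142 (m : nat) (s : 'S_m) : bool :=
  [exists i : 'I_m, exists j : 'I_m, exists k : 'I_m, exists l : 'I_m,
     [&& (i < j)%N, (j < k)%N, (k < l)%N,
         (s j < s l)%N, (s l < s i)%N & (s i < s k)%N]].

Definition Aset (m : nat) : {set 'S_m} :=
  [set s : 'S_m | [&& alternating s, ~~ contains2413 s & ~~ contains3142 s]].

Definition r_ (n : nat) : nat := #|Aset (n.*2.+1)|.
Definition t_ (n : nat) : nat := #|Aset (n.*2)|.

Definition fps := nat -> rat.
Definition fps_mul (a b : fps) : fps :=
  fun n => (\sum_(i < n.+1) a i * b (n - i)%N)%R.

Definition Rser : fps := fun n => if n == 0%N then 0%R else ((r_ n)%:R)%R.
Definition Tser : fps := fun n => if n == 0%N then 0%R else ((t_ n)%:R)%R.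

(* Main.v *)
Require Import Defs.
From HB Require Import structures.
From mathcomp Require Import all_boot all_order all_fingroup all_algebra.
From mathcomp Require Import zify ring.
Import Order.TTheory GRing.Theory Num.Theory.
Set Implicit Arguments.
Unset Strict Implicit.

(** A permutation of length at least 2 avoiding 2413 and 3142 is either a direct
    sum or a skew sum, never both.  Cutting a direct sum after its first
    indecomposable block splits an alternating separable word into two such
    words, and alternation only forces the parity of the cut; complementation
    exchanges direct and skew sums and the two directions of the first step.

    Let E be the series of the even lengths, A that of the direct sums among
    them, and w, s the series of the direct and skew sums of odd length at
    least 3, each odd length 2n+1 being marked by x^n.  Then
    A = x (1 + s) (1 + s + w), E = A + A E, w = (1 + s) E and
    s = A (1 + s + w).  With R = s + w this gives R = 2 E + R E and
    E = x (1 + R)^2, so that p = R / 2 satisfies p = x (1 + p) (1 + 2 p)^2, and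
    Lagrange inversion yields the coefficients of E = x (1 + 4 p + 4 p^2). *)

(** * Cuts of separable words: existence and exclusivity *)

(** The relation is a parameter so that one notion serves twice: [ltn] gives the cuts of direct
    sums, [gtn] those of skew sums. *)
Definition cut (lt : rel nat) (w : seq nat) (a : nat) : bool :=
  [&& 0 < a, a < size w & allrel lt (take a w) (drop a w)].

Definition no_2413_3142 (lt : rel nat) (w : seq nat) : Prop :=
  forall i j k l, i < j -> j < k -> k < l -> l < size w ->
    let x := nth 0 w in
    ~~ [&& lt (x k) (x i), lt (x i) (x l) & lt (x l) (x j)] /\
    ~~ [&& lt (x j) (x l), lt (x l) (x i) & lt (x i) (x k)].

Definition separable (w : seq nat) : bool :=
  [forall i : 'I_(size w), forall j : 'I_(size w), forall k : 'I_(size w),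
   forall l : 'I_(size w), [&& i < j, j < k & k < l] ==>
    let x := nth 0 w in
    ~~ [&& x k < x i, x i < x l & x l < x j] &&
    ~~ [&& x j < x l, x l < x i & x i < x k]].

(* [b] is the direction of the first step: [false] for an ascent. *)
Definition alternates (b : bool) (w : seq nat) : bool :=
  all (fun i => (nth 0 w i < nth 0 w i.+1) == ~~ (odd i (+) b))
      (iota 0 (size w).-1).

Lemma cutP (lt : rel nat) (w : seq nat) (a : nat) :
  reflect [/\ 0 < a, a < size w &
            forall i j, i < a -> a <= j -> j < size w ->
              lt (nth 0 w i) (nth 0 w j)]
          (cut lt w a).
Proof.
apply: (iffP and3P) => [] [a0 aw H]; split=> //.
  move=> i j ia aj jw; apply: (allrelP H).
    by rewrite -(nth_take 0 ia) mem_nth // size_take aw.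
  by rewrite -(subnKC aj) -nth_drop mem_nth // size_drop /=; lia.
apply/allrelP => x y /(nthP 0)[i]; rewrite size_take aw => ia <-.
move=> /(nthP 0)[j]; rewrite size_drop /= => jw <-.
by rewrite nth_take // nth_drop; apply: H => //; lia.
Qed.

Lemma separableP (w : seq nat) : reflect (no_2413_3142 ltn w) (separable w).
Proof.
apply: (iffP idP) => [H i j k l ij jk kl lw | H].
  have [iw jw kw] : [/\ i < size w, j < size w & k < size w] by split; lia.
  move/forallP: H => /(_ (Ordinal iw))/forallP/(_ (Ordinal jw))/forallP.
  move=> /(_ (Ordinal kw))/forallP/(_ (Ordinal lw))/implyP /=.
  by rewrite ij jk kl => /(_ isT)/andP.
apply/forallP=> i; apply/forallP=> j; apply/forallP=> k; apply/forallP=> l.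
by apply/implyP=> /and3P[ij jk kl]; apply/andP; apply: H.
Qed.

Lemma alternatesP (b : bool) (w : seq nat) :
  reflect (forall i, i.+1 < size w ->
             (nth 0 w i < nth 0 w i.+1) = ~~ (odd i (+) b))
          (alternates b w).
Proof.
apply: (iffP allP) => H i iw.
  by rewrite (eqP (H i _)) // mem_iota; lia.
by rewrite H //; move: iw; rewrite mem_iota; lia.
Qed.

(* Let [a] be the least cut of [w].  If the new last entry [z] is neither above
   nor below the whole first block, then avoiding 3142 puts the entries of that
   block below [z] before those above [z], giving a smaller cut. *)
Lemma cut_rcons (lt : rel nat) (w : seq nat) (z : nat) :
  transitive lt -> irreflexive lt ->
  (forall x y, x != y -> lt x y || lt y x) ->
  uniq (rcons w z) -> no_2413_3142 lt (rcons w z) ->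
  (exists a, cut lt w a) ->
  exists a, cut lt (rcons w z) a || cut (fun x y => lt y x) (rcons w z) a.
Proof.
move=> lt_tr lt_irr lt_tot; rewrite rcons_uniq => /andP[zw _] Hsep ex_a.
have [a /cutP[a0 aw Ha] amin] := ex_minnP ex_a.
have nthw i : i < size w -> nth 0 (rcons w z) i = nth 0 w i.
  by move=> iw; rewrite nth_rcons iw.
have nthz : nth 0 (rcons w z) (size w) = z by rewrite nth_rcons ltnn eqxx.
have low i : i < size w -> ~~ lt (nth 0 w i) z -> lt z (nth 0 w i).
  move=> iw /negbTE nlt; have /lt_tot : nth 0 w i != z.
    by apply: contraNneq zw => <-; apply: mem_nth.
  by rewrite nlt.
have [/(all_nthP 0) allu | ] := boolP (all (fun x => lt x z) (take a w)).
  exists a; apply/orP; left; apply/cutP; split=> //; first by rewrite size_rcons; lia.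
  rewrite size_rcons => i j ia aj jw; rewrite nthw; last by lia.
  have [jw'|jw'] := ltnP j (size w); first by rewrite nthw //; apply: Ha.
  have -> : j = size w by lia.
  rewrite nthz -(nth_take 0 ia); apply: allu; rewrite size_take aw //.
rewrite -has_predC => hasu.
(* The first position of the block whose entry is not below [z]. *)
set b := find (predC (lt^~ z)) (take a w).
have ba : b < a.
  by move: hasu; rewrite has_find size_take aw.
have zb : lt z (nth 0 w b).
  apply: low; first by lia.
  by rewrite -(nth_take 0 ba); apply: (nth_find 0 hasu).
have ltb i : i < b -> lt (nth 0 w i) z.
  move=> ib; have ia : i < a by lia.
  by have := before_find 0 ib; rewrite nth_take //= => /negbFE.
have geb i : b <= i -> i < a -> lt z (nth 0 w i).
  move=> bi ia; have iw : i < size w by lia.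
  apply: low => //; apply/negP => iz.
  have bi' : b < i.
    rewrite ltn_neqAle bi andbT; apply: contraTneq zb => ->.
    by apply/negP=> /(lt_tr _ _ _ iz); rewrite lt_irr.
  (* An entry below [z] after position [b] would form a 3142, read in the order [lt], with the
     entries at [b], [a] and the final [z]. *)
  have := Hsep b i a (size w) bi' ia aw; rewrite size_rcons => /(_ (leqnn _)) [_].
  by rewrite nthz !nthw // ?iz ?zb ?Ha //; lia.
(* If [b] is 0, the whole block is above [z], and so is everything after it: the last entry alone is
   cut off, in the converse order. *)
have [b0|b0] := posnP b.
  exists (size w); apply/orP; right; apply/cutP; rewrite size_rcons; split=> //; first by lia.
  move=> i j iw wj jw; have -> : j = size w by lia.
  rewrite nthz nthw //; have [ia|ai] := ltnP i a; first by apply: geb; lia.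
  by apply: (lt_tr _ _ _ zb); apply: Ha.
(* Otherwise [b] is a cut of [w] smaller than the least cut [a]. *)
suff /amin : cut lt w b by lia.
apply/cutP; split=> //; first by lia.
move=> i j ib bj jw; have [ja|aj] := ltnP j a; last by apply: Ha; lia.
by apply: (lt_tr z); [apply: ltb | apply: geb].
Qed.

(** Reversing the order of values exchanges the two patterns. *)
Lemma no_2413_3142_converse (lt : rel nat) (w : seq nat) :
  no_2413_3142 lt w -> no_2413_3142 (fun x y => lt y x) w.
Proof.
move=> H i j k l ij jk kl lw /=; have [H1 H2] := H i j k l ij jk kl lw.
by split; [apply: contra H2 | apply: contra H1] => /and3P[-> -> ->].
Qed.

(** Induction on the last entry: [cut_rcons] extends a cut of the shorter word, with [lt] taken as
    [ltn] or [gtn] according to the kind of that cut. *)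
Lemma separable_cut (w : seq nat) : 1 < size w -> uniq w ->
  separable w -> exists a, cut ltn w a || cut gtn w a.
Proof.
move=> w1 uw /separableP; elim/last_ind: w w1 uw => [|w z IH] //.
rewrite size_rcons => w1 uw sw.
have [w2|w2] := leqP (size w) 1.
  have {w1 w2}: size w = 1 by lia.
  case: w uw {sw IH} => [|x [|]] //=; rewrite !inE => uw _; exists 1.
  by rewrite /cut /allrel /= !andbT; lia.
have [||a /orP[ca|ca]] := IH w2.
- by move: uw; rewrite rcons_uniq => /andP[].
- move=> i j k l ij jk kl lw; have := sw i j k l ij jk kl.
  rewrite size_rcons => /(_ (leqW lw)) /=; rewrite !nth_rcons.
  by rewrite lw (ltn_trans kl lw) (ltn_trans jk (ltn_trans kl lw)) (ltn_trans ij (ltn_trans jk (ltn_trans kl lw))).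
- apply: (@cut_rcons ltn w z _ _ _ uw sw); last by exists a.
  + by move=> x y t /=; lia.
  + by move=> x /=; lia.
  + by move=> x y /=; lia.
- have [||||c] := @cut_rcons gtn w z _ _ _ uw (no_2413_3142_converse sw).
  + by move=> x y t /=; lia.
  + by move=> x /=; lia.
  + by move=> x y /=; lia.
  + by exists a.
  by rewrite orbC => hc; exists c.
Qed.

(** Each of the two cuts separates the first entry from the last, and they compare these in opposite
    ways. *)
Lemma cut_ltn_gtn (w : seq nat) (a c : nat) : cut ltn w a -> cut gtn w c -> False.
Proof.
move=> /cutP[a0 aw Ha] /cutP[c0 cw Hc].
have := Ha 0 (size w).-1; have := Hc 0 (size w).-1 => /=; lia.
Qed.

(** * Counted classes of permutation words *)

Definition perms (m : nat) : seq (seq nat) := permutations (iota 0 m).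

Definition decomposable (lt : rel nat) (w : seq nat) : bool :=
  has (cut lt w) (iota 0 (size w)).

Definition nall (b : bool) (m : nat) : nat :=
  count (fun w => alternates b w && separable w) (perms m).

Definition ndec (lt : rel nat) (b : bool) (m : nat) : nat :=
  count (fun w => [&& alternates b w, separable w & decomposable lt w]) (perms m).

Definition nindec (b : bool) (m : nat) : nat :=
  count (fun w => [&& alternates b w, separable w & ~~ decomposable ltn w])
    (perms m).

Lemma mem_perms (m : nat) (w : seq nat) : (w \in perms m) = perm_eq w (iota 0 m).
Proof. exact: mem_permutations. Qed.

Lemma size_perms (m : nat) (w : seq nat) : w \in perms m -> size w = m.
Proof. by rewrite mem_perms => /perm_size; rewrite size_iota. Qed.

Lemma uniq_perms (m : nat) (w : seq nat) : w \in perms m -> uniq w.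
Proof. by rewrite mem_perms => /perm_uniq ->; apply: iota_uniq. Qed.

Lemma nth_perms (m : nat) (w : seq nat) (i : nat) :
  w \in perms m -> i < m -> nth 0 w i < m.
Proof.
move=> wm im; have : nth 0 w i \in w by rewrite mem_nth // (size_perms wm).
by move: wm; rewrite mem_perms => /perm_mem ->; rewrite mem_iota.
Qed.

(** * Direct sums of permutation words *)

Definition dsum (u v : seq nat) : seq nat := u ++ map (addn (size u)) v.

Lemma size_dsum (u v : seq nat) : size (dsum u v) = size u + size v.
Proof. by rewrite size_cat size_map. Qed.

Lemma nth_dsuml (u v : seq nat) (i : nat) :
  i < size u -> nth 0 (dsum u v) i = nth 0 u i.
Proof. by move=> iu; rewrite nth_cat iu. Qed.

Lemma nth_dsumr (u v : seq nat) (i : nat) :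
  size u <= i -> i < size u + size v ->
  nth 0 (dsum u v) i = size u + nth 0 v (i - size u).
Proof. by move=> ui iv; rewrite nth_cat ltnNge ui (nth_map 0) //; lia. Qed.

Lemma cut_dsum (a n : nat) (u v : seq nat) : u \in perms a -> v \in perms n ->
  0 < a -> 0 < n -> cut ltn (dsum u v) a.
Proof.
move=> ua vn a0 n0; apply/cutP.
rewrite size_dsum (size_perms ua) (size_perms vn); split=> //; first by lia.
move=> i j ia aj jan; have := nth_perms ua ia.
by rewrite nth_dsuml ?nth_dsumr ?(size_perms ua) ?(size_perms vn) //=; lia.
Qed.

(** All of [v] is placed above [u], so a cut inside [u] extends to the sum. Hence the junction is
    the first cut exactly when [u] is indecomposable. *)
Lemma decomposable_dsum (a n : nat) (u v : seq nat) :
  u \in perms a -> v \in perms n -> 0 < a -> 0 < n ->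
  has (cut ltn (dsum u v)) (iota 0 a) = decomposable ltn u.
Proof.
move=> ua vn a0 n0; have su := size_perms ua; have sv := size_perms vn.
rewrite /decomposable su; apply: eq_in_has => c; rewrite mem_iota => /andP[_ ca].
apply/cutP/cutP; rewrite size_dsum su sv => -[c0 c1 H]; split=> //; try lia; last first.
- move=> i j ic cj jan; have [ja|aj] := ltnP j a.
    by rewrite !nth_dsuml ?su ?H //; lia.
  have ia : i < a by lia.
  have := nth_perms ua ia.
  by rewrite nth_dsuml ?nth_dsumr ?su ?sv //=; lia.
- move=> i j ic cj ja; have := H i j ic cj.
  by rewrite !nth_dsuml ?su; try lia; apply; lia.
Qed.

(** The step across the junction is always an ascent, at position [a.-1]; this fixes the parity of
    [a]. The steps of [v] are those of the sum shifted by [a]. *)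
Lemma alternates_dsum (a n : nat) (b : bool) (u v : seq nat) :
  u \in perms a -> v \in perms n -> 0 < a -> 0 < n ->
  alternates b (dsum u v) =
    [&& odd a (+) b, alternates b u & alternates (b (+) odd a) v].
Proof.
move=> ua vn a0 n0; have su := size_perms ua; have sv := size_perms vn.
apply/alternatesP/and3P; rewrite size_dsum su sv;
  last case=> H1 /alternatesP H2 /alternatesP H3.
  move=> H; split.
  - have := H a.-1; rewrite prednK // nth_dsuml ?su; last by lia.
    rewrite nth_dsumr ?su ?sv //; try lia.
    have -> : odd a = ~~ odd a.-1 by rewrite -[in LHS](prednK a0).
    have := @nth_perms _ _ a.-1 ua.
    by case: (odd a.-1); case: b {H} => //=; lia.
  - apply/alternatesP => i; rewrite su => ia; have := H i.
    by rewrite !nth_dsuml ?su; try lia; apply; lia.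
  - apply/alternatesP => i; rewrite sv => ia; have := H (a + i).
    rewrite !nth_dsumr ?su ?sv; try lia.
    rewrite addKn -addnS addKn !ltn_add2l => ->; last by lia.
    by rewrite oddD; case: (odd a); case: (odd i); case: b {H}.
move=> i iw; have [ia|ai] := ltnP i.+1 a.
  by rewrite !nth_dsuml ?su ?H2 ?su //; lia.
have [ia|ai'] := ltnP i a.
  have ea : a = i.+1 by lia.
  rewrite nth_dsuml ?su // nth_dsumr ?su ?sv //.
  have := nth_perms ua ia; move: H1; rewrite {1}ea /=.
  by case: (odd i); case: b {H2 H3} => //=; lia.
have := H3 (i - a); rewrite !nth_dsumr ?su ?sv //; last by lia.
rewrite subSn // !ltn_add2l => ->; last by lia.
by rewrite oddB //; case: (odd a); case: (odd i); case: b {H1 H2 H3}.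
Qed.

(** No proper prefix of 2413 or of 3142 lies entirely below the rest of the pattern, so an
    occurrence cannot straddle the junction. *)
Lemma separable_dsum (a n : nat) (u v : seq nat) :
  u \in perms a -> v \in perms n -> separable (dsum u v) = separable u && separable v.
Proof.
move=> ua vn; have su := size_perms ua; have sv := size_perms vn.
have lo i : i < a -> nth 0 (dsum u v) i = nth 0 u i.
  by move=> ia; rewrite nth_dsuml ?su.
have hi i : a <= i -> i < a + n -> nth 0 (dsum u v) i = a + nth 0 v (i - a).
  by move=> ai ian; rewrite nth_dsumr ?su ?sv.
apply/separableP/andP; rewrite /no_2413_3142 size_dsum su sv;
  last case=> /separableP H1 /separableP H2.
  move=> H; split; apply/separableP => i j k l ij jk kl;
    rewrite ?su ?sv => lw /=.
    by have := H i j k l ij jk kl; rewrite !lo; lia.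
  have := H (a + i) (a + j) (a + k) (a + l).
  rewrite !hi; try lia.
  by rewrite /= !ltn_add2l !addKn; apply=> //; lia.
have sep i j : i < a -> a <= j -> j < a + n -> nth 0 (dsum u v) i < nth 0 (dsum u v) j.
  by move=> ia aj jan; rewrite lo // hi //; have := nth_perms ua ia; lia.
move=> i j k l ij jk kl lw /=.
have [la|al] := ltnP l a.
  have := H1 i j k l ij jk kl; rewrite su => /(_ la) /=.
  by rewrite !lo //; lia.
have [ai|ia] := leqP a i.
  have := H2 (i - a) (j - a) (k - a) (l - a).
  by rewrite !hi /= ?sv; lia.
have [ja|aj] := ltnP j a; last first.
  have := sep i j ia aj; have := sep i k ia; have := sep i l ia; lia.
have [ka|ak] := ltnP k a; last first.
  have := sep j k ja ak; have := sep i l ia al; have := sep j l ja al; lia.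
have := sep j l ja al; have := sep k l ka al; have := sep i l ia al; lia.
Qed.

Lemma dsum_perms (a n : nat) (u v : seq nat) :
  u \in perms a -> v \in perms n -> dsum u v \in perms (a + n).
Proof.
move=> ua vn; rewrite mem_perms /dsum (size_perms ua) iotaD.
move: ua vn; rewrite !mem_perms => pu pv.
by apply: perm_cat => //; rewrite add0n -[X in iota X](addn0 a) iotaDl perm_map.
Qed.

Lemma perms_dsum (a n : nat) (w : seq nat) :
  w \in perms (a + n) -> cut ltn w a ->
  exists u v, [/\ u \in perms a, v \in perms n & w = dsum u v].
Proof.
rewrite mem_perms => pw /and3P[a0 aw /allrelP H].
have sw : size w = a + n by rewrite (perm_size pw) size_iota.
(* Sorting the two sides of the cut separately already sorts the whole word, so the left side
   consists of the values below [a]. *)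
pose s := sort leq (take a w) ++ sort leq (drop a w).
have st : size (sort leq (take a w)) = a by rewrite size_sort size_take aw.
have es : s = iota 0 (a + n).
  apply: (sorted_eq leq_trans anti_leq) => //.
  - rewrite sorted_pairwise; last exact: leq_trans.
    rewrite pairwise_cat -!sorted_pairwise; try exact: leq_trans.
    rewrite !(sort_sorted leq_total) !andbT; apply/allrelP => x y.
    by rewrite !mem_sort => xt yd; apply: ltnW; apply: H.
  - exact: iota_sorted.
  - apply: perm_trans pw; rewrite -[X in perm_eq _ X](cat_take_drop a w).
    by apply: perm_cat; rewrite perm_sort.
have pt : perm_eq (take a w) (iota 0 a).
  rewrite -(perm_sort leq) -[X in perm_eq X](take_size_cat (sort leq (drop a w)) st).
  by rewrite -/s es iotaD take_size_cat ?size_iota.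
have pd : perm_eq (drop a w) (iota a n).
  rewrite -(perm_sort leq) -[X in perm_eq X](drop_size_cat (sort leq (drop a w)) st).
  by rewrite -/s es iotaD drop_size_cat ?size_iota.
have ed : map (addn a) (map (subn^~ a) (drop a w)) = drop a w.
  rewrite -map_comp -[RHS]map_id; apply/eq_in_map => x.
  by rewrite (perm_mem pd) mem_iota /=; lia.
exists (take a w), (map (subn^~ a) (drop a w)); split.
- by rewrite mem_perms.
- rewrite mem_perms -(mapK (@addKn a) (iota 0 n)).
  by rewrite -iotaDl addn0 perm_map.
- by rewrite /dsum size_take aw ed cat_take_drop.
Qed.

Lemma dsum_inj (a : nat) (u v u' v' : seq nat) : size u = a -> size u' = a ->
  dsum u v = dsum u' v' -> u = u' /\ v = v'.
Proof.
move=> su su' /eqP; rewrite /dsum su su' eqseq_cat ?su //.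
by case/andP=> /eqP -> /eqP/(inj_map (@addnI a)).
Qed.

(** * Counting words by their first cut *)

(** [dsum] is a bijection from pairs of an indecomposable block and an arbitrary remainder; the
    boolean factor, read as 0 or 1, is the parity condition at the junction. *)
Lemma count_first_cut (b : bool) (a n : nat) : 0 < a -> 0 < n ->
  count (fun w => [&& alternates b w, separable w, cut ltn w a &
                      ~~ has (cut ltn w) (iota 0 a)]) (perms (a + n))
  = (odd a (+) b) * nindec b a * nall (b (+) odd a) n.
Proof.
move=> a0 n0; set P := fun w => _.
pose L1 := filter (fun w => [&& alternates b w, separable w & ~~ decomposable ltn w]) (perms a).
pose L2 := filter (fun w => alternates (b (+) odd a) w && separable w) (perms n).
have [ab|ab] := boolP (odd a (+) b); last first.
  rewrite !mul0n; apply/eqP; rewrite -leqn0 leqNgt -has_count; apply/hasPn => w.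
  move=> wp; apply/negP => /and4P[H1 _ H2 _].
  have [u [v [ua vn ew]]] := perms_dsum wp H2.
  by move: H1; rewrite ew (alternates_dsum _ ua vn) // (negbTE ab).
rewrite mul1n /nindec /nall -!size_filter -/L1 -/L2 -(size_allpairs dsum).
apply: perm_size; apply: uniq_perm.
- exact/filter_uniq/permutations_uniq.
- apply: allpairs_uniq; try exact/filter_uniq/permutations_uniq.
  move=> [u v] [u' v'] /allpairsP[[x y] /= [xL yL [-> ->]]] /allpairsP[[x' y'] /= [xL' yL' [-> ->]]].
  move: xL xL'; rewrite !mem_filter => /andP[_ /size_perms su] /andP[_ /size_perms su'].
  by case/(dsum_inj su su') => -> ->.
move=> w; apply/idP/allpairsP.
  rewrite mem_filter => /andP[/and4P[H1 H2 H3 H4] wp].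
  have [u [v [ua vn ew]]] := perms_dsum wp H3.
  exists (u, v); rewrite /L1 /L2 !mem_filter /= ua vn; split=> //.
    move: H1 H2 H4; rewrite ew (alternates_dsum _ ua vn) // (separable_dsum ua vn).
    by rewrite (decomposable_dsum ua vn) // => /and3P[_ -> _] /andP[-> _] ->.
  move: H1 H2; rewrite ew (alternates_dsum _ ua vn) // (separable_dsum ua vn).
  by move=> /and3P[_ _ ->] /andP[_ ->].
case=> -[u v] /= []; rewrite !mem_filter => /andP[/and3P[H1 H2 H3] ua] /andP[/andP[H4 H5] vn] ->.
rewrite dsum_perms // andbT /P (alternates_dsum _ ua vn) // (separable_dsum ua vn).
by rewrite (decomposable_dsum ua vn) // (cut_dsum ua vn) // H1 H2 H3 H4 H5 ab.
Qed.

Lemma count_has_first (T : Type) (P : pred T) (Q : T -> pred nat) (s : seq T) (k : nat) :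
  count (fun w => P w && has (Q w) (iota 0 k)) s
  = \sum_(0 <= a < k)
      count (fun w => [&& P w, Q w a & ~~ has (Q w) (iota 0 a)]) s.
Proof.
elim: k => [|k IH]; first by rewrite big_geq //; elim: s => //= x s ->; rewrite andbF.
rewrite big_nat_recr // -{}IH -addn1 iotaD add0n.
elim: s => //= x s ->; rewrite has_cat /= orbF.
by case: (P x); case: (has _ _); case: (Q x k) => //=; lia.
Qed.

(** * Complementation and the recurrence *)

Definition complement (m : nat) (w : seq nat) : seq nat :=
  map (fun x => m.-1 - x) w.

Lemma complementK (m : nat) (w : seq nat) :
  w \in perms m -> complement m (complement m w) = w.
Proof.
rewrite mem_perms /complement -map_comp => /perm_mem wm.
rewrite -[RHS]map_id; apply/eq_in_map => x.
by rewrite wm mem_iota /=; lia.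
Qed.

Lemma complement_perms (m : nat) (w : seq nat) :
  w \in perms m -> complement m w \in perms m.
Proof.
move=> wm; have uw := uniq_perms wm; move: wm; rewrite !mem_perms => /perm_mem wm.
apply: uniq_perm; first 1 last.
- exact: iota_uniq.
- move=> x; rewrite mem_iota; apply/mapP/idP => [[y]|xm].
    by rewrite wm mem_iota; lia.
  by exists (m.-1 - x); rewrite ?wm ?mem_iota; lia.
rewrite map_inj_in_uniq // => x y; rewrite !wm !mem_iota; lia.
Qed.

Lemma nth_complement (m : nat) (w : seq nat) (i : nat) : w \in perms m -> i < m ->
  nth 0 (complement m w) i = m.-1 - nth 0 w i.
Proof. by move=> wm im; rewrite (nth_map 0) ?(size_perms wm). Qed.

Lemma cut_complement (m : nat) (w : seq nat) (a : nat) : w \in perms m ->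
  cut ltn (complement m w) a = cut gtn w a.
Proof.
move=> wm; have wm' := complement_perms wm.
apply/cutP/cutP; rewrite (size_perms wm) (size_perms wm') => -[a0 am H]; split=> // i j ia aj jm;
  have im : i < m by [lia]; have := H i j ia aj jm;
  rewrite !nth_complement //= => H'; have := nth_perms wm im; have := nth_perms wm jm; lia.
Qed.

Lemma decomposable_complement (m : nat) (w : seq nat) : w \in perms m ->
  decomposable ltn (complement m w) = decomposable gtn w.
Proof.
move=> wm; rewrite /decomposable size_map; apply: eq_has => a.
exact: cut_complement.
Qed.

Lemma separable_complement (m : nat) (w : seq nat) : w \in perms m ->
  separable (complement m w) = separable w.
Proof.
move=> wm; have wm' := complement_perms wm.
apply/separableP/separableP => H i j k l ij jk kl;
  rewrite ?(size_perms wm) ?(size_perms wm') => lm;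
  have [im jm km] : [/\ i < m, j < m & k < m] by [split; lia];
  have := H i j k l ij jk kl;
  rewrite ?(size_perms wm) ?(size_perms wm') => /(_ lm) /=;
  rewrite !nth_complement //; have := nth_perms wm im; have := nth_perms wm jm;
  have := nth_perms wm km; have := nth_perms wm lm; lia.
Qed.

Lemma alternates_complement (b : bool) (m : nat) (w : seq nat) : w \in perms m ->
  alternates b (complement m w) = alternates (~~ b) w.
Proof.
move=> wm; have wm' := complement_perms wm.
have E i : i.+1 < m -> (nth 0 (complement m w) i < nth 0 (complement m w) i.+1)
    = ~~ (nth 0 w i < nth 0 w i.+1).
  move=> im; have im' := ltnW im; rewrite !nth_complement //.
  have : nth 0 w i != nth 0 w i.+1.
    by rewrite nth_uniq ?(size_perms wm) ?(uniq_perms wm) //; lia.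
  have := nth_perms wm im; have := nth_perms wm im'; lia.
apply/alternatesP/alternatesP; rewrite (size_perms wm) (size_perms wm') => H i im.
  by have := H i im; rewrite E // addbN => /negb_inj ->; rewrite negbK.
by rewrite E // H // addbN !negbK.
Qed.

Lemma count_complement (P : pred (seq nat)) (m : nat) :
  count (fun w => P (complement m w)) (perms m) = count P (perms m).
Proof.
rewrite -(count_map (complement m) P); apply/seq.permP/uniq_perm.
- rewrite map_inj_in_uniq ?permutations_uniq // => u v um vm e.
  by rewrite -(complementK um) e complementK.
- exact: permutations_uniq.
move=> w; apply/mapP/idP => [[u um ->]|wm]; first exact: complement_perms.
by exists (complement m w); rewrite ?complement_perms ?complementK.
Qed.

Lemma ndec_gtn (b : bool) (m : nat) : ndec gtn b m = ndec ltn (~~ b) m.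
Proof.
rewrite /ndec -[RHS](count_complement _ m); apply: eq_in_count => w wm.
by rewrite alternates_complement ?separable_complement ?decomposable_complement ?negbK.
Qed.

(** From length 2 on, a word is a direct sum or a skew sum and not both; complementation counts the
    skew sums as direct sums with the other first step. The single letter is neither. *)
Lemma nall_split (b : bool) (m : nat) : 0 < m ->
  nall b m = ndec ltn b m + ndec ltn (~~ b) m + (m == 1).
Proof.
case: m => [|[|m]] // _.
  rewrite /nall /ndec (_ : perms 1 = [:: [:: 0]]) //=.
  have -> : separable [:: 0] by apply/separableP => i j k l ? ? ? /=; lia.
  by rewrite /decomposable /=.
rewrite -ndec_gtn /nall /ndec -count_predUI addn0.
rewrite [X in _ + X](_ : _ = 0) ?addn0; last first.
  apply/eqP; rewrite -leqn0 leqNgt -has_count; apply/hasPn => w _ /=.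
  apply/negP => /andP[/and3P[_ _ /hasP[a _ ca]] /and3P[_ _ /hasP[c _ cc]]].
  exact: cut_ltn_gtn ca cc.
apply: eq_in_count => w wm /=; case: (alternates b w) => //=.
have [sw|] //= := boolP (separable w); symmetry.
have [|a /orP[ca|ca]] := separable_cut _ (uniq_perms wm) sw.
- by rewrite (size_perms wm).
- apply/orP; left; apply/hasP; exists a => //.
  by have /cutP[_ ? _] := ca; rewrite mem_iota.
- apply/orP; right; apply/hasP; exists a => //.
  by have /cutP[_ ? _] := ca; rewrite mem_iota.
Qed.

(** Removing the direct sums from [nall_split] leaves the skew sums and the single letter. *)
Lemma nindecE (b : bool) (m : nat) : 0 < m ->
  nindec b m = ndec ltn (~~ b) m + (m == 1).
Proof.
move=> m0; apply: (@addnI (ndec ltn b m)); rewrite addnA -nall_split //.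
rewrite /ndec /nindec /nall -count_predUI [X in _ + X](_ : _ = 0) ?addn0.
  apply: eq_count => w /=.
  by case: (alternates b w); case: (separable w); case: (decomposable ltn w).
apply/eqP; rewrite -leqn0 leqNgt -has_count; apply/hasPn => w _ /=.
by case: (decomposable ltn w); rewrite ?andbF.
Qed.

Lemma ndec0 (lt : rel nat) (b : bool) : ndec lt b 0 = 0.
Proof. by rewrite /ndec /perms /= !andbF. Qed.

(* The number of words of length [m], except that it vanishes at [m = 0]. *)
Definition npos (m : nat) : nat := ndec ltn false m + ndec ltn true m + (m == 1).

Lemma npos_nall (b : bool) (m : nat) : 0 < m -> nall b m = npos m.
Proof. by move=> m0; rewrite nall_split // /npos; case: b => //=; lia. Qed.

(** Sum over the first cut [a]. The end terms [a = 0] and [a = m] vanish; including them makes the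
    sum a full convolution once the parity is fixed. *)
Lemma ndec_rec (b : bool) (m : nat) :
  ndec ltn b m =
    \sum_(0 <= a < m.+1 | odd a (+) b)
      (ndec ltn (~~ b) a + (a == 1)) * npos (m - a).
Proof.
rewrite big_mkcond big_nat_recr //= subnn /npos !ndec0 muln0 if_same addn0.
have -> : ndec ltn b m =
    count (fun w => (alternates b w && separable w) && has (cut ltn w) (iota 0 m)) (perms m).
  by apply: eq_in_count => w wm; rewrite -andbA /decomposable (size_perms wm).
rewrite count_has_first; apply: eq_big_nat => a am.
have [->|a0] := posnP a.
  rewrite ndec0 mul0n if_same; apply/eqP; rewrite -leqn0 leqNgt -has_count.
  by apply/hasPn => w _; rewrite /cut ltnn andbF.
have [n0 em] : 0 < m - a /\ m = a + (m - a) by lia.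
rewrite [in perms m]em -/(npos _).
have := count_first_cut b a0 n0; under eq_count do rewrite andbA; move=> ->.
by rewrite nindecE // (npos_nall _ n0); case: (odd a (+) b); rewrite ?mul1n ?mul0n.
Qed.

(** * Permutations as words *)

Definition word (m : nat) (s : 'S_m) : seq nat := [seq val (s i) | i <- enum 'I_m].

Lemma size_word (m : nat) (s : 'S_m) : size (word s) = m.
Proof. by rewrite size_map size_enum_ord. Qed.

Lemma nth_word (m : nat) (s : 'S_m) (i : 'I_m) : nth 0 (word s) i = s i.
Proof. by rewrite (nth_map i) ?size_enum_ord // nth_ord_enum. Qed.

Lemma word_inj (m : nat) : injective (@word m).
Proof.
by move=> s s' e; apply/permP => i; apply: val_inj; rewrite /= -!nth_word e.
Qed.

Lemma word_perms (m : nat) (s : 'S_m) : word s \in perms m.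
Proof.
have uw : uniq (word s).
  by rewrite map_inj_uniq ?enum_uniq // => i j /val_inj/perm_inj.
rewrite mem_perms; apply: uniq_perm; rewrite ?iota_uniq // => x.
rewrite mem_iota /=; apply/mapP/idP => [[i _ ->]|xm]; first exact: ltn_ord.
by exists (s^-1 (Ordinal xm))%g; rewrite ?mem_enum // permKV.
Qed.

Lemma perms_word (m : nat) (w : seq nat) : w \in perms m -> exists s : 'S_m, word s = w.
Proof.
move=> wm; pose f (i : 'I_m) := Ordinal (nth_perms wm (ltn_ord i)).
have f_inj : injective f.
  move=> i j /(congr1 val) /= /eqP.
  by rewrite nth_uniq ?(size_perms wm) ?(uniq_perms wm) // => /eqP/val_inj.
exists (perm f_inj); apply: (@eq_from_nth _ 0); first by rewrite size_word (size_perms wm).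
rewrite size_word => i im; have -> : i = Ordinal im by [].
by rewrite nth_word permE.
Qed.

Lemma alternating_word (m : nat) (s : 'S_m) : alternating s = alternates false (word s).
Proof.
apply/idP/alternatesP; rewrite size_word => H.
  move=> i im; have im' := ltnW im.
  move/forallP: H => /(_ (Ordinal im'))/forallP/(_ (Ordinal im)).
  rewrite eqxx /= -!nth_word /= addbF.
  by case: (odd i); lia.
apply/forallP => i; apply/forallP => j; apply/implyP => /eqP ji.
have := H i; rewrite -ji ltn_ord => /(_ isT); rewrite !nth_word addbF.
have : s i != s j by rewrite (inj_eq perm_inj); apply/eqP => ij; move: ji; rewrite ij; lia.
by rewrite -val_eqE /=; case: (odd i) => /=; lia.
Qed.

Lemma separable_word (m : nat) (s : 'S_m) :
  separable (word s) = ~~ contains2413 s && ~~ contains3142 s.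
Proof.
apply/separableP/andP => [H | [H1 H2] i j k l ij jk kl].
  split; apply/negP => /existsP[i] /existsP[j] /existsP[k] /existsP[l];
    move=> /and4P[ij jk kl sijkl]; have := H i j k l ij jk kl;
    by rewrite size_word ltn_ord /= !nth_word sijkl => /(_ isT) [].
rewrite size_word => lm.
have [im jm km] : [/\ i < m, j < m & k < m] by split; lia.
have E q (qm : q < m) : nth 0 (word s) q = s (Ordinal qm) by rewrite -nth_word.
split; [move: H1 | move: H2]; apply: contra => H;
  apply/existsP; exists (Ordinal im); apply/existsP; exists (Ordinal jm);
  apply/existsP; exists (Ordinal km); apply/existsP; exists (Ordinal lm);
  by rewrite /= ij jk kl -!E.
Qed.

Lemma card_Aset (m : nat) : #|Aset m| = nall false m.
Proof.
rewrite cardE -(size_map (@word m)) /nall -size_filter.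
apply/perm_size/uniq_perm.
- by rewrite (map_inj_uniq (@word_inj m)) enum_uniq.
- exact/filter_uniq/permutations_uniq.
move=> w; rewrite mem_filter; apply/mapP/andP => [[s]|[Hw /perms_word[s es]]].
  by rewrite mem_enum inE alternating_word -separable_word => ? ->; rewrite word_perms.
by exists s; rewrite ?es // mem_enum inE alternating_word -separable_word es.
Qed.

(** * Generating functions *)

Local Open Scope ring_scope.

Lemma sum_odd (F : nat -> nat) (n : nat) :
  (\sum_(0 <= a < n | odd a) F a = \sum_(i < n./2) F i.*2.+1)%N.
Proof.
elim: n => [|n IH]; first by rewrite big_geq // big_ord0.
rewrite big_mkcond big_nat_recr //= -big_mkcond IH uphalf_half.
have [on|_] := boolP (odd n); last by rewrite addn0.
by rewrite add1n big_ord_recr /= -[in F n](odd_double_half n) on.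
Qed.

Lemma sum_even (F : nat -> nat) (n : nat) :
  (\sum_(0 <= a < n | ~~ odd a) F a = \sum_(i < uphalf n) F i.*2)%N.
Proof.
elim: n => [|n IH]; first by rewrite big_geq // big_ord0.
rewrite big_mkcond big_nat_recr //= -big_mkcond IH uphalf_half.
have [on|on] := boolP (odd n); first by rewrite add1n addn0.
by rewrite big_ord_recr /= -[in F n](odd_double_half n) (negbTE on).
Qed.

(* Words starting with an ascent; by complementation the skew sums among them are
   as many as the direct sums starting with a descent, whence [true] in
   [odd_skew]. *)
Definition one : fps := fun n => (n == 0%N)%:R.
Definition even_sum : fps := fun n => (ndec ltn false n.*2)%:R.
Definition even_all : fps := fun n => (npos n.*2)%:R.
Definition odd_sum : fps := fun n => (ndec ltn false n.*2.+1)%:R.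
Definition odd_skew : fps := fun n => (ndec ltn true n.*2.+1)%:R.

Lemma even_sum0 : even_sum 0 = 0.
Proof. by rewrite /even_sum ndec0. Qed.

Lemma npos_odd (n : nat) :
  (npos n.*2.+1)%:R = one n + odd_skew n + odd_sum n :> rat.
Proof.
by rewrite /npos eqSS double_eq0 !natrD /one /odd_skew /odd_sum; ring.
Qed.

(** The first cut is odd, so both parts have odd length, [2i+1] and [2(n-i)+1]; the two extra
    letters account for the shift from [n] to [n.+1]. *)
Lemma even_sum_rec (n : nat) :
  even_sum n.+1 = fps_mul (fun i => one i + odd_skew i)
                    (fun i => one i + odd_skew i + odd_sum i) n.
Proof.
rewrite /even_sum ndec_rec (eq_bigl odd) => [|a]; last by rewrite addbF.
rewrite sum_odd /= uphalf_double natr_sum; apply: eq_bigr => i _.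
have -> : (n.+1.*2 - i.*2.+1 = (n - i).*2.+1)%N by have := ltn_ord i; lia.
by rewrite natrM npos_odd natrD eqSS double_eq0 addrC.
Qed.

(** The skew sums are counted as direct sums starting with a descent; their first block has even
    length and is counted by [even_sum]. *)
Lemma even_all_rec (n : nat) :
  even_all n = even_sum n + fps_mul even_sum even_all n.
Proof.
rewrite /even_all /npos (_ : (n.*2 == 1)%N = false); last by lia.
rewrite addn0 natrD; congr (_ + _).
rewrite ndec_rec (eq_bigl (fun a => ~~ odd a)) => [|a]; last by rewrite addbT.
rewrite sum_even /= doubleK natr_sum.
apply: eq_bigr => i _; rewrite natrM -doubleB (_ : (i.*2 == 1)%N = false) ?addn0 //.
by lia.
Qed.

Lemma odd_sum_rec (n : nat) :
  odd_sum n = fps_mul (fun i => one i + odd_skew i) even_all n.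
Proof.
rewrite /odd_sum ndec_rec (eq_bigl odd) => [|a]; last by rewrite addbF.
rewrite sum_odd /= doubleK natr_sum; apply: eq_bigr => i _.
have -> : (n.*2.+1 - i.*2.+1 = (n - i).*2)%N by have := ltn_ord i; lia.
by rewrite natrM natrD eqSS double_eq0 addrC.
Qed.

Lemma odd_skew_rec (n : nat) :
  odd_skew n = fps_mul even_sum (fun i => one i + odd_skew i + odd_sum i) n.
Proof.
rewrite /odd_skew ndec_rec (eq_bigl (fun a => ~~ odd a)) => [|a]; last by rewrite addbT.
rewrite sum_even /= uphalf_double natr_sum; apply: eq_bigr => i _.
have -> : (n.*2.+1 - i.*2 = (n - i).*2.+1)%N by have := ltn_ord i; lia.
rewrite natrM npos_odd (_ : (i.*2 == 1)%N = false) ?addn0 //.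
by lia.
Qed.

Lemma Tser_even_all (n : nat) : Tser n = even_all n.
Proof.
rewrite /Tser /even_all; case: eqP => [->|n0]; first by rewrite /npos !ndec0.
by rewrite /t_ card_Aset npos_nall //; lia.
Qed.

Lemma Rser_odd (n : nat) : Rser n = odd_skew n + odd_sum n.
Proof.
have E m : (r_ m)%:R = one m + odd_skew m + odd_sum m :> rat.
  by rewrite /r_ card_Aset npos_nall // npos_odd.
rewrite /Rser; case: eqP => [->|n0]; last by rewrite E /one; case: n n0 => //= n _; ring.
(* The index 0 stands for length 1, where there is no cut, in agreement with the value 0 given to
   [Rser] there. *)
have -> : odd_skew 0 = 0.
  by rewrite odd_skew_rec /fps_mul big_ord1 even_sum0 mul0r.
rewrite odd_sum_rec /fps_mul big_ord1 [even_all _](_ : _ = 0) ?mulr0 ?addr0 //.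
by rewrite /even_all /npos !ndec0.
Qed.

(** * Truncated series and the functional equations *)

(** Series identities become polynomial identities modulo ['X^N] with an explicit cofactor, so that
    [ring] can combine them. *)
Definition trunc (N : nat) (f : fps) : {poly rat} := \poly_(i < N) f i.

Lemma coef_trunc (N n : nat) (f : fps) : (n < N)%N -> (trunc N f)`_n = f n.
Proof. by move=> nN; rewrite coef_poly nN. Qed.

Lemma truncD (N : nat) (f g : fps) : trunc N (fun i => f i + g i) = trunc N f + trunc N g.
Proof. by apply/polyP => i; rewrite coefD !coef_poly; case: ifP; rewrite ?addr0. Qed.

Lemma trunc1 (N : nat) : trunc N.+1 one = 1.
Proof.
by apply/polyP => i; rewrite coef1 coef_poly /one; case: i => //= i; rewrite if_same.
Qed.

Lemma coef_truncM (N n : nat) (f g : fps) : (n < N)%N ->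
  (trunc N f * trunc N g)`_n = fps_mul f g n.
Proof.
move=> nN; rewrite coefM; apply: eq_bigr => i _.
by rewrite !coef_trunc //; have := ltn_ord i; lia.
Qed.

Lemma poly_congr (N : nat) (p q : {poly rat}) :
  (forall n, (n < N)%N -> p`_n = q`_n) -> exists c, p - q = c * 'X^N.
Proof.
move=> H; exists (drop_poly N (p - q)).
rewrite -[LHS](poly_take_drop N) [X in X + _](_ : _ = 0) ?add0r //.
apply/polyP => i; rewrite coef_take_poly coef0; case: ifP => // iN.
by rewrite coefB H // subrr.
Qed.

Lemma coef_congr (N n : nat) (p q c : {poly rat}) : (n < N)%N ->
  p - q = c * 'X^N -> p`_n = q`_n.
Proof.
move=> nN H; apply/eqP; rewrite -subr_eq0 -coefB H coefMXn nN //.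
Qed.

Lemma series_congr (N : nat) :
  let r := trunc N.+1 Rser in let t := trunc N.+1 Tser in
  (exists c, r - (2%:R * t + r * t) = c * 'X^(N.+1)) /\
  (exists c, t - 'X * (1 + r) ^+ 2 = c * 'X^(N.+1)).
Proof.
pose a := trunc N.+1 even_sum; pose e := trunc N.+1 even_all.
pose s := trunc N.+1 odd_skew; pose w := trunc N.+1 odd_sum.
have Es : trunc N.+1 (fun i => one i + odd_skew i) = 1 + s by rewrite truncD trunc1.
have Eo : trunc N.+1 (fun i => one i + odd_skew i + odd_sum i) = 1 + s + w.
  by rewrite truncD Es.
have [c1 H1] : exists c, a - 'X * ((1 + s) * (1 + s + w)) = c * 'X^(N.+1).
  apply: poly_congr => -[|n] nN; rewrite coefXM coef_trunc //= ?even_sum0 //.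
  by rewrite -Eo -Es coef_truncM ?even_sum_rec // ltnW.
have [c2 H2] : exists c, e - (a + a * e) = c * 'X^(N.+1).
  by apply: poly_congr => n nN; rewrite coefD coef_truncM // !coef_trunc // even_all_rec.
have [c3 H3] : exists c, w - (1 + s) * e = c * 'X^(N.+1).
  by apply: poly_congr => n nN; rewrite -Es coef_truncM // coef_trunc // odd_sum_rec.
have [c4 H4] : exists c, s - a * (1 + s + w) = c * 'X^(N.+1).
  by apply: poly_congr => n nN; rewrite -Eo coef_truncM // coef_trunc // odd_skew_rec.
move=> r t.
have -> : r = s + w.
  by apply/polyP => i; rewrite coefD !coef_poly; case: ifP; rewrite ?Rser_odd ?addr0.
have -> : t = e by apply/polyP => i; rewrite !coef_poly; case: ifP; rewrite ?Tser_even_all.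
split.
  (* Modulo the power of ['X], [s(1+e) = a(1+e)(1+s+w) = e(1+s+w)]; adding [w = e + se] gives
     [s+w = 2e + (s+w)e]. *)
  exists (c4 * (1 + e) + c3 - c2 * (1 + s + w)).
  rewrite [RHS](_ : _ = (c4 * 'X^(N.+1)) * (1 + e) + c3 * 'X^(N.+1) - (c2 * 'X^(N.+1)) * (1 + s + w)); last by ring.
  by rewrite -H2 -H3 -H4; ring.
(* Here [e = a(1+e)], [a = X(1+s)(1+s+w)], and [(1+s)(1+e) = 1+s+w] by the equation for [w]. *)
exists (c2 + c1 * (1 + e) - 'X * (1 + s + w) * c3).
rewrite [RHS](_ : _ = c2 * 'X^(N.+1) + (c1 * 'X^(N.+1)) * (1 + e) - 'X * (1 + s + w) * (c3 * 'X^(N.+1))); last by ring.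
by rewrite -H1 -H2 -H3; ring.
Qed.

Lemma Rser_Tser (n : nat) :
  (1 / 2%:R) * Rser n = (1 / 2%:R) * fps_mul Rser Tser n + Tser n.
Proof.
have [[c H] _] := series_congr n.
have := coef_congr (ltnSn n) H.
rewrite coefD coef_truncM // mulr_natl coefMn !coef_trunc // => ->.
by field.
Qed.

(** * Lagrange inversion for polynomials modulo a power of ['X] *)

(** Both sides are ['X] times the derivative of ['X^k * phi]; this absorbs the weights [k + j] that
    the induction in [lagrange_inversion] produces. *)
Lemma weighted_poly_sum (phi : {poly rat}) (k : nat) :
  \sum_(j < size phi) (phi`_j * (k + j)%:R) *: 'X^(k + j)
  = k%:R *: ('X^k * phi) + 'X^(k.+1) * phi^`().
Proof.
transitivity ('X^k * \poly_(j < size phi) (phi`_j * (k + j)%:R)).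
  rewrite poly_def mulr_sumr; apply: eq_bigr => j _.
  by rewrite -scalerAr exprD.
rewrite scalerAr exprSr -mulrA -mulrDr; congr (_ * _); apply/polyP => i.
rewrite coef_poly coefD coefZ coefXM coef_deriv.
have -> : (if (i < size phi)%N then phi`_i * (k + i)%:R else 0) = phi`_i * (k + i)%:R.
  by case: ltnP => // /(nth_default 0) ->; rewrite mul0r.
case: i => [|i] /=; first by rewrite addn0 addr0 mulrC.
by rewrite natrD mulrDr -[phi`_i.+1 *+ _]mulr_natr [_ * k%:R]mulrC.
Qed.

(* Lagrange inversion; both sides vanish for [k > n], so no bound on [k] is needed. *)
Lemma lagrange_inversion (phi p c : {poly rat}) (N n k : nat) :
  p - 'X * (phi \Po p) = c * 'X^N -> (n < N)%N ->
  n%:R * (p ^+ k)`_n = k%:R * ('X^k * phi ^+ n)`_n.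
Proof.
move=> Hp; elim: n k => [|n IH] k nN.
  by rewrite mul0r mulr1 coefXn eq_sym; case: k => [|k]; rewrite ?mul0r ?mulr0.
case: k => [|k]; first by rewrite expr0 coef1 mulr0 mul0r.
(* One factor [p] is replaced by ['X * (phi \Po p)], which lowers the index by one. *)
have step : (p ^+ k.+1)`_n.+1 = (p ^+ k * (phi \Po p))`_n.
  transitivity ('X * (p ^+ k * (phi \Po p)))`_n.+1; last by rewrite coefXM.
  apply: (coef_congr nN (c := p ^+ k * c)).
  by rewrite -mulrA -Hp exprS; ring.
have -> : ('X^(k.+1) * phi ^+ n.+1)`_n.+1 = ('X^k * phi ^+ n.+1)`_n.
  by rewrite exprS -mulrA coefXM.
rewrite step; set Q := ('X^k * phi ^+ n.+1)`_n.
case: n IH nN step @Q => [|n] IH nN step Q.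
  (* The induction hypothesis at index 0 carries no information, so index 1 is done directly with
     constant terms. *)
  have p0 : p.[0] = 0.
    rewrite horner_coef0 (coef_congr (ltnW nN) Hp) coefXM //.
  rewrite mul1r /Q -!horner_coef0 !hornerM horner_comp !horner_exp hornerX p0 expr1.
  by case: k {IH step Q}  => [|k]; rewrite ?mul1r // exprS !mul0r mulr0.
have n0 : n.+1%:R != 0 :> rat by rewrite pnatr_eq0.
apply: (mulfI n0).
(* Expand [phi \Po p] in powers of [p] and apply the induction hypothesis to each [p ^+ (k + j)]. *)
have key : n.+1%:R * (p ^+ k * (phi \Po p))`_n.+1
         = k%:R * Q + ('X^(k.+1) * phi^`() * phi ^+ n.+1)`_n.+1.
  rewrite comp_polyE mulr_sumr coef_sum mulr_sumr.
  rewrite (eq_bigr (fun j : 'I_(size phi) => ((phi`_j * (k + j)%:R) *: 'X^(k + j) * phi ^+ n.+1)`_n.+1)).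
    rewrite -coef_sum -mulr_suml weighted_poly_sum /Q -coefZ -coefD; congr (nth 0 (polyseq _) _).
    by rewrite (exprS phi n.+1) -!mul_polyC; ring.
  move=> j _; rewrite -scalerAr coefZ -exprD mulrCA IH ?(ltnW nN) //.
  by rewrite -!scalerAl coefZ mulrA.
(* The same coefficient of the derivative of ['X^(k.+1) * phi ^+ n.+2] is computed directly and by
   the product rule. *)
have der : n.+2%:R * ('X^(k.+1) * phi^`() * phi ^+ n.+1)`_n.+1 = (n.+2%:R - k.+1%:R) * Q.
  have : ('X^(k.+1) * phi ^+ n.+2)^`()`_n.+1 = n.+2%:R * Q.
    by rewrite coef_deriv exprS -mulrA coefXM /= mulr_natl.
  rewrite derivM derivXn deriv_exp /= coefD => H.
  rewrite mulrBl -H /Q !mulr_natl -!coefMn -coefD -coefB; congr (nth 0 (polyseq _) _).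
  by ring.
rewrite mulrCA key mulrDr der; ring.
Qed.

(** * Coefficient extraction and the closed formula *)

Lemma coef_linear_exp (c : rat) (m i : nat) :
  ((1 + c *: 'X) ^+ m)`_i = c ^+ i * 'C(m, i)%:R.
Proof.
elim: m i => [|m IH] i.
  by rewrite expr0 coef1 bin0n; case: i => [|i] //=; rewrite ?mulr0 ?mul1r.
rewrite exprS mulrDl mul1r -scalerAl coefD coefZ coefXM IH.
case: i => [|i] /=; first by rewrite mulr0 addr0 !bin0.
by rewrite IH binS natrD exprS; ring.
Qed.

Lemma Tser_formula (m : nat) : (0 < m)%N ->
  m%:R * Tser m.+1
  = 4%:R * \sum_(0 <= i < m) 2%:R ^+ i * 'C(m.*2.+1, i)%:R * 'C(m, i.+1)%:R.
Proof.
move=> m0; have [[c1 H1] [c2 H2]] := series_congr m.+1.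
set r := trunc _ Rser in H1 H2; set t := trunc _ Tser in H1 H2.
have half : (1 / 2%:R)%:P * 2%:R = 1 :> {poly rat}.
  by rewrite -polyC1 -polyCMn -polyCM; congr (_%:P); field.
pose p := (1 / 2%:R)%:P * r; have rp : r = 2%:R * p.
  by rewrite /p mulrA [_ * _%:P]mulrC half mul1r.
(* The equation for [p], half of the series R, is [p = X(1+p)(1+2p)^2]; the coefficient 1 is written
   out to fit [coef_linear_exp]. *)
pose phi : {poly rat} := (1 + 1 *: 'X) * (1 + 2%:R *: 'X) ^+ 2.
have comp : phi \Po p = (1 + p) * (1 + 2%:R * p) ^+ 2.
  rewrite /phi rmorphM rmorphXn !rmorphD /= !comp_polyZ comp_polyX rmorph1.
  by rewrite scale1r -mul_polyC polyCMn.
(* Half of the first congruence, [p = t + pt], plus [1 + p] times the second, [t = X(1+2p)^2]. *)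
have Hp : p - 'X * (phi \Po p) = ((1 / 2%:R)%:P * c1 + (1 + p) * c2) * 'X^(m.+2).
  rewrite mulrDl -!mulrA -H1 -H2 comp rp.
  have -> : (2%:R * p - (2%:R * t + 2%:R * p * t)) = 2%:R * (p - (t + p * t)) by ring.
  by rewrite [_%:P * _]mulrA half; ring.
have lag k := lagrange_inversion k Hp (ltnW (ltnSn m.+1)).
(* Expand [t = X(1 + 4p + 4p^2)]; the constant 1 contributes nothing since [m] is positive. *)
have -> : Tser m.+1 = 4%:R * (p ^+ 1)`_m + 4%:R * (p ^+ 2)`_m.
  rewrite -(coef_trunc Tser (ltnSn m.+1)) -/t (coef_congr (ltnSn m.+1) H2) coefXM /= rp.
  rewrite (_ : (1 + 2%:R * p) ^+ 2 = 1 + 4%:R *: p ^+ 1 + 4%:R *: p ^+ 2).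
    by rewrite !coefD !coefZ coef1 (gtn_eqF m0) add0r.
  by rewrite -!mul_polyC !polyCMn; ring.
rewrite mulrDr ![m%:R * (4%:R * _)]mulrCA !lag -mulrDr mul1r -coefZ -coefD.
congr (4%:R * _).
(* The cases [k = 1] and [k = 2] of Lagrange inversion combine to [X(1+2X) phi^m], whose extra
   factor makes the exponent of [1+2X] equal to [2m+1]. *)
have -> : 'X^1 * phi ^+ m + 2%:R *: ('X^2 * phi ^+ m)
    = 'X * ((1 + 2%:R *: 'X) ^+ m.*2.+1 * (1 + 1 *: 'X) ^+ m).
  by rewrite /phi exprMn -exprM mul2n [_ ^+ m.*2.+1]exprS -!mul_polyC; ring.
rewrite coefXM (gtn_eqF m0) coefM prednK // big_mkord; apply: eq_bigr => i _.
rewrite !coef_linear_exp expr1n mul1r; congr (_ * _%:R).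
(* Symmetry of binomials: the index [m-1-i] becomes [i+1]. *)
by rewrite -bin_sub; [congr 'C(_, _)|]; have := ltn_ord i; lia.
Qed.

Theorem theorem6p2 :
  (forall n : nat,
     (1 / 2) * Rser n = (1 / 2) * fps_mul Rser Tser n + Tser n)
  /\ t_ 1 = 1%N
  /\ (forall n : nat, (2 <= n)%N ->
        (t_ n)%:R = (4 / (n.-1)%:R) *
          \sum_(0 <= i < n.-1) 2 ^+ i * ('C(n.*2.-1, i))%:R * ('C(n.-1, i.+1))%:R
        :> rat).
Proof.
split; first exact: Rser_Tser.
split.
  rewrite /t_ card_Aset /nall (_ : perms _ = [:: [:: 0; 1]; [:: 1; 0]]%N) //=.
  have -> : separable [:: 0; 1]%N by apply/separableP => i j k l ? ? ? /=; lia.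
  by rewrite /alternates.
case=> [|[|m]] // _; have := Tser_formula (ltn0Sn m); rewrite /Tser /= => H.
have n0 : m.+1%:R != 0 :> rat by rewrite pnatr_eq0.
by apply: (mulfI n0); rewrite H mulrA [m.+1%:R * _]mulrC divfK.
Qed.
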